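(* Let $s,n\in\mathbb N$ with $s\le n$ and let $p,q,R,\alpha,\eta>0$ satisfy $$p\le\frac1{2^{11}s^2},\qquad 2p\le q\le\alpha<1,\qquad R\ge2^{-6}pn,\qquad\eta\le\frac{(1-\alpha)^{2s}}4.$$ Let $\mathcal H$ be an $s$-uniform hypergraph with $n$ vertices and let $$\mathcal J=\{L\subset V(\mathcal H):\mathcal H[L]\text{ is }(p/(q-p),\eta R)\text{-Janson}\}.$$ Then there exist a family $\mathcal Y\subset2^{V(\mathcal H)}\times2^{V(\mathcal H)}$ and functions $g:\mathcal I(\mathcal J)\to\mathcal Y$, $f:\mathcal Y\to2^{V(\mathcal H)}$ such that: (1) for every $I\in\mathcal I(\mathcal J)$, if $g(I)=(S,T)$ then $S\cup T\subset I\subset f(S,T)$; (2) every $(S,T)\in\mathcal Y$ satisfies $|S|\le2^{11}ps^2n$ and $|T|\le qn/\alpha$; (3) for every $Y\in\mathcal Y$, the hypergraph $\mathcal H[f(Y)]$ is not $(p,R)$-Janson.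
   Context: A hypergraph is identified with its edge set; $\mathcal H[L]=\{E\in\mathcal H:E\subset L\}$. $\mathcal I(\mathcal J)$ denotes the family of independent sets of $\mathcal J$ (subsets of the vertex set $V(\mathcal H)$ containing no edge of $\mathcal J$). For $\nu:\mathcal G\to\mathbb R_{\ge0}$: $e(\nu)=\sum_E\nu(E)$, $d_\nu(L)=\sum_{E\in\mathcal G,L\subset E}\nu(E)$, $\Lambda_p(\nu)=\sum_{L\subset V(\mathcal G),|L|\ge2}d_\nu(L)^2p^{-|L|}$. For $p,R>0$, $\mathcal G$ is $(p,R)$-Janson if some $\nu:\mathcal G\to\mathbb R_{\ge0}$ has $\Lambda_p(\nu)<e(\nu)^2/R$. *)

(* Defs.v *)
From mathcomp Require Import all_boot all_order all_algebra.
From mathcomp Require Import reals.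
Set Implicit Arguments. Unset Strict Implicit. Unset Printing Implicit Defensive.
Import Order.TTheory GRing.Theory Num.Theory.
Local Open Scope ring_scope.

(* A hypergraph on the finite vertex type V is identified with its edge set. *)
Definition hgraph (V : finType) := {set {set V}}.

Definition induced (V : finType) (H : hgraph V) (L : {set V}) : hgraph V :=
  [set E in H | E \subset L].

Definition uniform (V : finType) (s : nat) (H : hgraph V) : Prop :=
  forall E, E \in H -> #|E| = s.

Section Janson.
Variables (R : realType) (V : finType).

Definition e_nu (G : hgraph V) (nu : {set V} -> R) : R := \sum_(E in G) nu E.

Definition d_nu (G : hgraph V) (nu : {set V} -> R) (L : {set V}) : R :=
  \sum_(E in G | L \subset E) nu E.

Definition Lambda (G : hgraph V) (nu : {set V} -> R) (p : R) : R :=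
  \sum_(L : {set V} | (2 <= #|L|)%N) (d_nu G nu L) ^+ 2 * p ^- #|L|.

Definition janson (G : hgraph V) (p r : R) : Prop :=
  exists nu : {set V} -> R,
    (forall E, E \in G -> 0 <= nu E) /\
    Lambda G nu p < (e_nu G nu) ^+ 2 / r.
End Janson.

Definition independent (V : finType) (J : {set V} -> Prop) (I : {set V}) : Prop :=
  forall L, J L -> ~ (L \subset I).

(* Main.v *)
Require Import Defs.
From mathcomp Require Import all_boot all_order all_algebra.
From mathcomp Require Import reals boolp ring lra.
Set Implicit Arguments.
Unset Strict Implicit.
Unset Printing Implicit Defensive.
Import Order.TTheory GRing.Theory Num.Theory.
Local Open Scope ring_scope.

(** Let [pi T] be the probability that the union of [T] and a [q]-random set
    contains no member of [J].  Given [I], take for [T] a subset of [I] of maximal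
    size subject to [pi T <= (1 - alpha) ^+ #|T|]; as [pi T >= (1 - q) ^+ n], it
    has at most [q n / alpha] elements.  Call an edge [E] bad if
    [pi (T :|: E) < (1 - alpha) ^+ s * pi T]: by maximality [I] contains no bad
    edge.

    The set [S] and the container come from a container lemma for the hypergraph
    of bad edges: query a vertex [v] as long as conditioning on [v] lowers the
    probability that a [p]-random set is free of bad edges by a factor
    [1 - delta], where [delta = 1 / (2 ^+ 11 * s ^+ 2)]; put [v] into [S] if it is
    in [I] and delete it otherwise.  When no query is left, the remaining
    hypergraph is not [(p, r / 4)]-Janson: exposing the vertices of the random
    set one at a time, the total weight [e(nu)] has to be lost through the exposed
    degrees, whose variances add up to at most [p * Lambda]; Harris' inequality
    transfers the variance bound to the random set conditioned to be edge-free.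

    Finally, if [H[D]] is [(p, r)]-Janson through [nu], then a second moment
    argument on a [q]-random set conditioned to avoid [J] shows that the bad edges
    carry more than half of [nu], so that they are [(p, r / 4)]-Janson on [D]. *)

(** * Expectations over random subsets and Harris' inequality *)

Section RandomSubset.
Variables (R : realFieldType) (V : finType).
Implicit Types (p : R) (l : seq V) (phi psi : {set V} -> R) (A B D : {set V}).

(** The vertices of a random subset of density [p] are exposed one at a time, so that identities
    become inductions on [l]. *)
Fixpoint expect p l phi : R :=
  if l is v :: l' then
    p * expect p l' (fun A => phi (v |: A)) + (1 - p) * expect p l' phi
  else phi set0.

Lemma eq_expect_sub p l phi psi :
  (forall A, {subset A <= l} -> phi A = psi A) -> expect p l phi = expect p l psi.
Proof.
elim: l phi psi => [|v l IH] phi psi h /=; first by apply: h => x; rewrite inE.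
congr (_ * _ + _ * _); apply: IH => A Al; apply: h => x.
  by rewrite !inE => /orP[->//|/Al->]; rewrite orbT.
by move=> /Al xl; rewrite inE xl orbT.
Qed.

Lemma eq_expect p l phi psi : phi =1 psi -> expect p l phi = expect p l psi.
Proof. by move=> h; apply: eq_expect_sub => A _; apply: h. Qed.

Lemma expectD p l phi psi :
  expect p l (fun A => phi A + psi A) = expect p l phi + expect p l psi.
Proof. by elim: l phi psi => [|v l IH] phi psi //=; rewrite !IH; ring. Qed.

Lemma expectZ p l c phi : expect p l (fun A => c * phi A) = c * expect p l phi.
Proof. by elim: l phi => [|v l IH] phi //=; rewrite !IH; ring. Qed.

Lemma expect_cst p l c : expect p l (fun=> c) = c.
Proof. by elim: l => [|v l IH] //=; rewrite !IH; ring. Qed.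

Lemma expect_sum p l (I : Type) (s : seq I) (P : pred I) (F : I -> {set V} -> R) :
  expect p l (fun A => \sum_(i <- s | P i) F i A)
  = \sum_(i <- s | P i) expect p l (F i).
Proof.
elim: s => [|i s IH].
  by under eq_expect do rewrite big_nil; rewrite expect_cst big_nil.
rewrite big_cons -IH; case: ifP => Pi.
  by rewrite -expectD; apply: eq_expect => A; rewrite big_cons Pi.
by apply: eq_expect => A; rewrite big_cons Pi.
Qed.

Section Order.
Variable p : R.
Hypotheses (p0 : 0 <= p) (p1 : p <= 1).

Let q0 : 0 <= 1 - p. Proof. by rewrite subr_ge0. Qed.

Lemma le_expect l phi psi :
  (forall A, phi A <= psi A) -> expect p l phi <= expect p l psi.
Proof.
elim: l phi psi => [|v l IH] phi psi h //=.
by apply: lerD; apply: ler_wpM2l => //; apply: IH.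
Qed.

Lemma expect_ge0 l phi : (forall A, 0 <= phi A) -> 0 <= expect p l phi.
Proof. by move=> h; rewrite -[leLHS](expect_cst p l); apply: le_expect. Qed.

Lemma expect_ge_set0 l phi :
  (forall A, 0 <= phi A) -> (1 - p) ^+ size l * phi set0 <= expect p l phi.
Proof.
elim: l phi => [|v l IH] phi h /=; first by rewrite mul1r.
rewrite exprS -mulrA -[leLHS]add0r lerD ?ler_wpM2l ?IH //.
by rewrite mulr_ge0// expect_ge0.
Qed.

(** Each exposed vertex leaves a surplus of [p * (1 - p)] times the product of the two one-step
    differences, both nonnegative by monotonicity. *)
Lemma harris l phi psi :
  (forall A B, A \subset B -> phi B <= phi A) ->
  (forall A B, A \subset B -> psi A <= psi B) ->
  expect p l (fun A => phi A * psi A) <= expect p l phi * expect p l psi.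
Proof.
elim: l phi psi => [|v l IH] phi psi dec inc //=.
have dec1 A B : A \subset B -> phi (v |: B) <= phi (v |: A).
  by move=> AB; apply/dec/setUS.
have inc1 A B : A \subset B -> psi (v |: A) <= psi (v |: B).
  by move=> AB; apply/inc/setUS.
have := IH _ _ dec inc; have := IH _ _ dec1 inc1.
have : expect p l (fun A => phi (v |: A)) <= expect p l phi.
  by apply: le_expect => A; apply/dec/subsetUr.
have : expect p l psi <= expect p l (fun A => psi (v |: A)).
  by apply: le_expect => A; apply/inc/subsetUr.
set a0 := expect p l phi; set b0 := expect p l psi.
set a1 := expect p l (fun A => phi (v |: A)).
set b1 := expect p l (fun A => psi (v |: A)) => b01 a10 h1 h0.
apply: (le_trans (lerD (ler_wpM2l p0 h1) (ler_wpM2l q0 h0))).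
rewrite -subr_ge0.
have -> : (p * a1 + (1 - p) * a0) * (p * b1 + (1 - p) * b0)
    - (p * (a1 * b1) + (1 - p) * (a0 * b0)) = p * (1 - p) * ((a0 - a1) * (b1 - b0)).
  by ring.
by rewrite !mulr_ge0// subr_ge0.
Qed.

End Order.

(** Any vertex can be exposed first. The inner means may still run over all of [l], as neither
    integrand depends on whether [v] lies in [A]. *)
Lemma expect_split p l v phi : uniq l -> v \in l ->
  expect p l phi = p * expect p l (fun A => phi (v |: A))
                   + (1 - p) * expect p l (fun A => phi (A :\ v)).
Proof.
elim: l phi => [//|w l IH] phi /= /andP[wl ul]; rewrite inE.
have [<-|vw /= vl] := eqVneq w v.
  have h0 : expect p l (fun A => phi (A :\ w)) = expect p l phi.
    apply: eq_expect_sub => A Al; congr phi; apply/setDidPl.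
    by rewrite disjoint_sym disjoints1; apply: contra wl => /Al.
  have h1 : expect p l (fun A => phi ((w |: A) :\ w)) = expect p l phi.
    rewrite -h0; apply: eq_expect => A; congr phi.
    by apply/setP => x; rewrite !inE; case: eqVneq.
  have h2 : expect p l (fun A => phi (w |: (w |: A)))
      = expect p l (fun A => phi (w |: A)).
    by apply: eq_expect => A; rewrite setUA setUid.
  by move=> _; rewrite h0 h1 h2; ring.
rewrite (IH (fun A => phi (w |: A))) // [in LHS](IH phi) //.
have h1 : expect p l (fun A => phi (w |: (v |: A)))
    = expect p l (fun A => phi (v |: (w |: A))).
  by apply: eq_expect => A; rewrite setUCA.
have h2 : expect p l (fun A => phi (w |: (A :\ v)))
    = expect p l (fun A => phi ((w |: A) :\ v)).
  apply: eq_expect => A; congr phi; apply/setP => x; rewrite !inE.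
  by case: (eqVneq x w) => [->|//]; rewrite vw.
by rewrite h1 h2; ring.
Qed.

Lemma expect_mem p v phi :
  expect p (enum V) (fun A => phi A * (v \in A)%:R)
  = p * expect p (enum V) (fun A => phi (v |: A)).
Proof.
rewrite (@expect_split _ _ v) ?enum_uniq ?mem_enum//.
under eq_expect do rewrite setU11 mulr1.
under [X in _ + _ * X]eq_expect do rewrite !inE eqxx mulr0.
by rewrite expect_cst mulr0 addr0.
Qed.

(** Conditioning on [D \subset A] amounts to adding [D]; its vertices are peeled off one by one. *)
Lemma expect_subset p D phi :
  expect p (enum V) (fun A => phi A * (D \subset A)%:R)
  = p ^+ #|D| * expect p (enum V) (fun A => phi (D :|: A)).
Proof.
move: {2}#|D| (erefl #|D|) => k; elim: k D phi => [|k IH] D phi.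
  move=> D0; rewrite D0 mul1r; move/eqP: D0; rewrite cards_eq0 => /eqP->.
  by apply: eq_expect => A; rewrite sub0set mulr1 set0U.
move=> Dk; have /card_gt0P[v vD] : (0 < #|D|)%N by rewrite Dk.
have Dvk : #|D :\ v| = k by move: Dk; rewrite (cardsD1 v) vD => -[].
rewrite Dk exprS -mulrA -Dvk.
transitivity (p * expect p (enum V)
    (fun A => phi (v |: A) * (D :\ v \subset A)%:R)).
  transitivity (p * expect p (enum V)
      (fun A => phi (v |: A) * (D :\ v \subset v |: A)%:R)); last first.
    congr (_ * _); apply: eq_expect => A; congr (_ * _%:R); congr nat_of_bool.
    by rewrite -subDset setDDl setUid.
  rewrite -(expect_mem p v (fun A => phi A * (D :\ v \subset A)%:R)).
  apply: eq_expect => A; rewrite -mulrA -natrM mulnb -[in LHS](setD1K vD).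
  by rewrite subUset sub1set andbC.
rewrite (IH _ (fun A => phi (v |: A)))// Dvk; congr (_ * (_ * _)).
by apply: eq_expect => A; rewrite setUA setD1K.
Qed.

Lemma expect_subset1 p D :
  expect p (enum V) (fun A => (D \subset A)%:R) = p ^+ #|D|.
Proof.
have := expect_subset p D (fun=> 1); rewrite expect_cst mulr1 => <-.
by apply: eq_expect => A; rewrite mul1r.
Qed.

End RandomSubset.

(* AM-GM applied to [k] factors [1 - b] and [n - k] factors [1]. *)
Lemma exponent_bound (R : realFieldType) (a b : R) (n k : nat) :
  0 < b -> b <= 1 -> a < 1 -> (k <= n)%N ->
  (1 - a) ^+ n <= (1 - b) ^+ k -> k%:R <= a * n%:R / b.
Proof.
move=> b0 b1 a1 kn le_ab.
rewrite ler_pdivlMr//.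
case: n kn le_ab => [|n] kn le_ab.
  by move: kn; rewrite leqn0 => /eqP->; rewrite mul0r mulr0.
set m := n.+1 in kn le_ab *.
have m0 : 0 < m%:R :> R by rewrite ltr0n.
pose F (i : 'I_m) : R := if (i < k)%N then 1 - b else 1.
have F0 i : i \in predT -> 0 <= F i by rewrite /F; case: ifP => _ _; lra.
have cnt : #|[pred i : 'I_m | (i < k)%N]| = k.
  rewrite -sum1_card -(big_ord_widen_cond m (fun=> true) (fun=> 1%N) kn).
  by rewrite sum1_card card_ord.
have prodF : \prod_(i in predT) F i = (1 - b) ^+ k.
  by rewrite /F -big_mkcond/= prodr_const; congr (_ ^+ _).
have sumF : \sum_(i in predT) F i = m%:R - k%:R * b.
  rewrite (eq_bigr (fun i : 'I_m => 1 - (if (i < k)%N then b else 0))); last first.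
    by move=> i _; rewrite /F; case: ifP => _; rewrite ?subr0.
  rewrite sumrB sumr_const card_ord -big_mkcond/= sumr_const cnt.
  by rewrite [k%:R * b]mulrC mulr_natr.
have := leif_AGM F0; rewrite prodF sumF card_ord => /leif_le agm.
have le1 : (1 - a) ^+ m <= ((m%:R - k%:R * b) / m%:R) ^+ m := le_trans le_ab agm.
have kb : k%:R * b <= m%:R by rewrite -[leRHS]mulr1 ler_pM// ?ler_nat// ltW.
move: le1; rewrite ler_pXn2r// ?nnegrE ?divr_ge0 ?subr_ge0 ?(ltW a1) ?(ltW m0)//.
by rewrite ler_pdivlMr// mulrBl mul1r lerD2l lerN2.
Qed.


(** * Initial segments in a fixed vertex order, and pair weights *)

Section Below.
Variables (R : realFieldType) (V : finType).
Implicit Types (K L : {set V}) (t u : V).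

Definition below K t := [set u in K | (enum_rank u < enum_rank t)%N].

Lemma belowI K L t : below (K :&: L) t = below K t :&: below L t.
Proof.
by apply/setP => u; rewrite !inE; case: (u \in K); case: (u \in L); rewrite ?andbF ?andbb.
Qed.

(** [K] is built up along the enumeration of [V]; vertices outside [K] change nothing. *)
Lemma telescope_below (w : {set V} -> R) K :
  w set0 - w K = \sum_(t in K) (w (below K t) - w (t |: below K t)).
Proof.
pose K_ i := [set u in K | (enum_rank u < i)%N].
have K0 : K_ 0%N = set0 by apply/setP => u; rewrite !inE ltn0 andbF.
have KV : K_ #|V| = K by apply/setP => u; rewrite !inE ltn_ord andbT.
rewrite -[in LHS]KV -K0 -opprB -(telescope_sumr (fun i => w (K_ i)))// big_mkord.
rewrite -sumrN (reindex enum_rank); last exact/onW_bij/enum_rank_bij.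
rewrite [RHS]big_mkcond/=; apply: eq_bigr => t _; rewrite opprB.
case: ifP => tK.
  congr (w _ - w _); apply/setP => u; rewrite !inE ltnS leq_eqVlt.
  have [->|ut] := eqVneq u t; first by rewrite tK eqxx.
  by rewrite (inj_eq val_inj) (inj_eq enum_rank_inj) (negPf ut).
suff -> : K_ (enum_rank t).+1 = K_ (enum_rank t) by rewrite subrr.
apply/setP => u; rewrite !inE ltnS leq_eqVlt.
have [->|ut] := eqVneq u t; first by rewrite tK.
by rewrite (inj_eq val_inj) (inj_eq enum_rank_inj) (negPf ut).
Qed.

Lemma setU1_below_inj K : {in K &, injective (fun t => t |: below K t)}.
Proof.
move=> t u tK uK tu; apply/eqP; apply/negPn/negP => neq.
have : t \in u |: below K u by rewrite -tu setU11.
have : u \in t |: below K t by rewrite tu setU11.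
rewrite !inE eq_sym (negPf neq) tK uK /= => h1 h2.
by move: (ltn_trans h1 h2); rewrite ltnn.
Qed.

(** For [K = E :&: E'] this is the coefficient of [nu E * nu E'] in [Lambda]. *)
Definition pair_weight (p : R) K : R :=
  \sum_(L : {set V} | (2 <= #|L|)%N && (L \subset K)) p ^- #|L|.

Lemma pair_weight_ge0 (p : R) K : 0 <= p -> 0 <= pair_weight p K.
Proof. by move=> p0; apply: sumr_ge0 => L _; rewrite invr_ge0 exprn_ge0. Qed.

(** The first element of [K] contributes zero. Any other term is at most
    [p * p ^- #|t |: below K t|], and these segments are distinct subsets of [L] with at least two
    elements. *)
Lemma sum_below_le (p : R) K L : 0 < p -> K \subset L ->
  \sum_(t in K) (p ^- #|below K t| - 1) <= p * pair_weight p L.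
Proof.
move=> p0 KL.
pose h t := t |: below K t.
pose S := [set t in K | below K t != set0].
have inv0 k : 0 <= p ^- k by rewrite invr_ge0 exprn_ge0// ltW.
apply: (@le_trans _ _ (\sum_(t in S) p * p ^- #|h t|)).
  rewrite big_mkcond [leRHS]big_mkcond; apply: ler_sum => t _; rewrite !inE.
  case: (boolP (t \in K)) => //= tK; have [->|_] := eqVneq (below K t) set0.
    by rewrite cards0 expr0 invr1 subrr.
  rewrite /h cardsU1 !inE ltnn andbF/= exprS invfM mulrA divff ?gt_eqF// mul1r.
  by rewrite lerBlDr lerDl.
rewrite -mulr_sumr ler_pM2l// -(big_imset (fun L => p ^- #|L|)) /=; last first.
  move=> t u; rewrite !inE => /andP[tK _] /andP[uK _]; exact: setU1_below_inj.
rewrite big_mkcond [leRHS]big_mkcond; apply: ler_sum => M _.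
case: ifP => [/imsetP[t]|_]; last by case: ifP.
rewrite inE => /andP[tK nz] ->; rewrite /h cardsU1 !inE ltnn andbF/=.
rewrite -[2%N]/(1 + 1)%N leq_add2l card_gt0 nz/= subUset sub1set (subsetP KL)//=.
by case: ifP => // /negP[]; apply/subsetP => u; rewrite inE => /andP[/(subsetP KL)].
Qed.

End Below.

Section PairSums.
Variables (R : realType) (V : finType).
Implicit Types (G : hgraph V) (nu : {set V} -> R).

Lemma Lambda_pairs G nu (p : R) :
  Lambda G nu p = \sum_(E in G) \sum_(E' in G)
    nu E * nu E' * pair_weight p (E :&: E').
Proof.
transitivity (\sum_(L : {set V} | (2 <= #|L|)%N) \sum_(E in G) \sum_(E' in G)
    nu E * nu E' * (if L \subset E :&: E' then p ^- #|L| else 0)).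
  apply: eq_bigr => L _; rewrite /d_nu expr2 !big_mkcondr big_distrlr mulr_suml.
  apply: eq_bigr => E _; rewrite mulr_suml; apply: eq_bigr => E' _.
  rewrite subsetI.
  by case: (L \subset E); case: (L \subset E'); rewrite /= ?(mul0r, mulr0).
rewrite exchange_big; apply: eq_bigr => E _; rewrite exchange_big; apply: eq_bigr => E' _.
by rewrite -mulr_sumr /pair_weight big_mkcondr.
Qed.

Lemma Lambda_ge0 G nu (p : R) : 0 <= p -> 0 <= Lambda G nu p.
Proof.
by move=> p0; apply: sumr_ge0 => L _; rewrite mulr_ge0 ?sqr_ge0 ?invr_ge0 ?exprn_ge0.
Qed.

End PairSums.

(** * A mass bound when no vertex is worth querying *)

Section Stuck.
Variables (R : realType) (V : finType) (p : R) (G : hgraph V) (nu : {set V} -> R).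
Variable U : {set V}.
Hypotheses (p0 : 0 < p) (p1 : p <= 1) (nu0 : forall E, E \in G -> 0 <= nu E).

Let P (phi : {set V} -> R) := expect p (enum V) phi.
Let low t (E : {set V}) := below (E :&: U) t.

Definition degree t : R := \sum_(E in G | t \in E) nu E.

(* The conditional expectation, given the part of the random set [A] below [t],
   of the [nu]-weight of the edges through [t] that lie in [t |: A], each edge
   being divided by the probability of this event. *)
Definition exposed_degree t (A : {set V}) : R :=
  \sum_(E in G | t \in E) nu E * (p ^- #|low t E| * (low t E \subset A)%:R).

Let px k : p ^+ k != 0. Proof. by rewrite expf_neq0// gt_eqF. Qed.

Let p_ge0 : 0 <= p. Proof. exact: ltW. Qed.

Lemma exposed_degree_mono t (A B : {set V}) :
  A \subset B -> exposed_degree t A <= exposed_degree t B.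
Proof.
move=> AB; apply: ler_sum => E /andP[EG _]; rewrite ler_wpM2l ?nu0//.
rewrite ler_wpM2l ?invr_ge0 ?exprn_ge0// ler_nat.
by case: (boolP (_ \subset A)) => // /subset_trans->.
Qed.

Lemma expect_exposed_degree t : P (exposed_degree t) = degree t.
Proof.
rewrite /P /exposed_degree expect_sum; apply: eq_bigr => E _.
by rewrite !expectZ expect_subset1 mulVf ?mulr1.
Qed.

(** Both lower parts lie in [A] with probability [p] to the size of their union; dividing by the two
    single probabilities leaves the intersection. *)
Lemma expect_exposed_degree_sqr t :
  P (fun A => exposed_degree t A ^+ 2) =
  \sum_(E in G | t \in E) \sum_(E' in G | t \in E')
    nu E * nu E' * p ^- #|below (E :&: E' :&: U) t|.
Proof.
rewrite /P.
under eq_expect do rewrite expr2 big_distrlr /=.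
rewrite expect_sum; apply: eq_bigr => E _; rewrite expect_sum; apply: eq_bigr => E' _.
transitivity (expect p (enum V) (fun A => nu E * nu E' *
    (p ^- #|low t E| * p ^- #|low t E'|) * (low t E :|: low t E' \subset A)%:R)).
  by apply: eq_expect => A; rewrite subUset -mulnb natrM; ring.
rewrite expectZ expect_subset1 -[LHS]mulrA; congr (_ * _).
have -> : below (E :&: E' :&: U) t = low t E :&: low t E'.
  by rewrite /low -belowI; congr below; rewrite setIACA setIid.
have := cardsUI (low t E) (low t E'); set a := #|_|; set b := #|_|.
set c := #|low t E|; set d := #|low t E'| => abcd.
by rewrite -invfM -exprD -abcd exprD invfM mulrAC mulVf ?mul1r.
Qed.

(** A pair of edges through [t] contributes [p ^- #|below (E :&: E' :&: U) t| - 1], weighted by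
    [nu]; [sum_below_le] sums this over [t]. *)
Lemma exposed_degree_variance :
  \sum_(t in U) P (fun A => (exposed_degree t A - degree t) ^+ 2) <= p * Lambda G nu p.
Proof.
have var t : P (fun A => (exposed_degree t A - degree t) ^+ 2) =
    \sum_(E in G) \sum_(E' in G) nu E * nu E' *
      (if t \in E :&: E' then p ^- #|below (E :&: E' :&: U) t| - 1 else 0).
  transitivity (P (fun A => exposed_degree t A ^+ 2) - degree t ^+ 2).
    transitivity (P (fun A => exposed_degree t A ^+ 2
        + (- 2 * degree t * exposed_degree t A + degree t ^+ 2))).
      by apply: eq_expect => A; ring.
    have := expect_exposed_degree t; rewrite /P => mean.
    by rewrite !expectD expectZ expect_cst mean; ring.
  rewrite expect_exposed_degree_sqr expr2 /degree big_distrlr /= -sumrB big_mkcondr.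
  apply: eq_bigr => E _; case: ifP => tE; last first.
    by rewrite big1// => E' _; rewrite inE tE mulr0.
  rewrite -sumrB big_mkcondr; apply: eq_bigr => E' _; rewrite inE tE/=.
  by case: ifP => _; ring.
under eq_bigr do rewrite var.
rewrite exchange_big Lambda_pairs mulr_sumr; apply: ler_sum => E EG.
rewrite exchange_big mulr_sumr; apply: ler_sum => E' E'G.
rewrite -mulr_sumr mulrCA ler_wpM2l ?mulr_ge0 ?nu0//.
apply: le_trans (sum_below_le p0 (subsetIl (E :&: E') U)).
rewrite big_mkcond [leRHS]big_mkcond; apply: ler_sum => t _.
by rewrite !inE; case: (t \in U); case: (t \in E); case: (t \in E').
Qed.

Variable F : {set V} -> R.
Hypotheses (F0 : forall A : {set V}, 0 <= F A)
  (Fdec : forall A B : {set V}, A \subset B -> F B <= F A)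
  (FG : forall (E A : {set V}), E \in G -> E :&: U \subset A -> F A = 0).

Let b t A := F A - F (t |: A).

(** For an edge [E], the mean of [F (D :|: A)] falls from [P F] to zero as [D] grows to [E :&: U];
    the loss at [t] is the mean of [b t A] on [low t E \subset A], divided by nothing but counted
    with the factor [p ^+ #|low t E|] removed. *)
Lemma mass_drift :
  e_nu G nu * P F = \sum_(t in U) P (fun A => b t A * exposed_degree t A).
Proof.
transitivity (\sum_(E in G) \sum_(t in U | t \in E)
    nu E * (p ^- #|low t E| * P (fun A => b t A * (low t E \subset A)%:R))).
  rewrite mulr_suml; apply: eq_bigr => E EG; rewrite -mulr_sumr; congr (_ * _).
  have := telescope_below (fun D => P (fun A => F (D :|: A))) (E :&: U).
  have -> : P (fun A => F (set0 :|: A)) = P F by apply: eq_expect => A; rewrite set0U.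
  have -> : P (fun A => F (E :&: U :|: A)) = 0.
    rewrite /P -[RHS](expect_cst p (enum V)); apply: eq_expect => A.
    exact: FG EG (subsetUl _ _).
  rewrite subr0 => ->; apply: eq_big => [t|t _]; first by rewrite inE andbC.
  rewrite /P expect_subset mulrA mulVf// mul1r /b.
  rewrite -[X in _ - X]mul1r -mulNr -expectZ -expectD; apply: eq_expect => A.
  by rewrite mulN1r setUA.
rewrite (exchange_big_dep (fun t => t \in U))/=; last by move=> E t _ /andP[].
apply: eq_bigr => t tU; rewrite /P.
under [RHS]eq_expect do rewrite /exposed_degree mulr_sumr.
rewrite expect_sum; apply: eq_big => [E|E _]; first by rewrite tU.
by rewrite mulrA -expectZ; apply: eq_expect => A; ring.
Qed.

(** The exposed degree is at most its mean plus an excess. The mean and the constant part of AM-GM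
    use that [b t] has mean at most [delta * P F]; the squared excess uses [b t A <= F A], Harris
    and the variance bound. *)
Lemma stuck_mass_bound (delta lambda : R) : 0 < lambda ->
  (forall t, t \in U -> (1 - delta) * P F <= P (fun A => F (t |: A))) ->
  e_nu G nu * P F <= P F * (delta * \sum_(t in U) degree t
    + lambda / 2 * delta * #|U|%:R + p * Lambda G nu p / (2 * lambda)).
Proof.
move=> l0 stuck.
have b0 t A : 0 <= b t A by rewrite subr_ge0 Fdec ?subsetUr.
have bF t A : b t A <= F A by rewrite lerBlDr lerDl.
have Pb t : t \in U -> P (b t) <= delta * P F.
  move=> /stuck h.
  have -> : P (b t) = P F - P (fun A => F (t |: A)).
    rewrite -[X in _ - X]mul1r -mulNr /P -expectZ -expectD.
    by apply: eq_expect => A; rewrite mulN1r.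
  lra.
have PF0 : 0 <= P F by apply: expect_ge0.
(* The positive part keeps the square increasing in [A], as Harris requires. *)
pose y t A : R := Num.max 0 (exposed_degree t A - degree t).
have y0 t A : 0 <= y t A by rewrite /y le_max lexx.
have Py t : P (fun A => F A * y t A ^+ 2)
    <= P F * P (fun A => (exposed_degree t A - degree t) ^+ 2).
  have inc (A B : {set V}) : A \subset B -> y t A ^+ 2 <= y t B ^+ 2.
    move=> AB; rewrite lerXn2r ?nnegrE ?y0// /y ge_max !le_max lexx/=.
    by rewrite lerD2r exposed_degree_mono// orbT.
  apply: (le_trans (harris p_ge0 p1 (enum V) Fdec inc)).
  rewrite ler_wpM2l//; apply: le_expect => // A.
  rewrite /y; have [_|_] := leP 0 (exposed_degree t A - degree t) => //.
  by rewrite expr0n sqr_ge0.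
rewrite mass_drift.
apply: (@le_trans _ _ (\sum_(t in U) (degree t * (delta * P F)
   + (lambda / 2 * (delta * P F)
   + (2 * lambda)^-1 * (P F * P (fun A => (exposed_degree t A - degree t) ^+ 2)))))).
  apply: ler_sum => t tU.
  apply: (@le_trans _ _ (P (fun A => degree t * b t A
      + (lambda / 2 * b t A + (2 * lambda)^-1 * (F A * y t A ^+ 2))))).
    apply: le_expect => // A.
    have d_y : exposed_degree t A <= degree t + y t A.
      by rewrite -lerBlDl /y le_max lexx orbT.
    have amgm : y t A <= lambda / 2 + (2 * lambda)^-1 * y t A ^+ 2.
      rewrite -subr_ge0.
      have -> : lambda / 2 + (2 * lambda)^-1 * y t A ^+ 2 - y t A
          = (2 * lambda)^-1 * (y t A - lambda) ^+ 2 by field; rewrite gt_eqF.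
      by rewrite mulr_ge0 ?sqr_ge0// invr_ge0 mulr_ge0// ltW.
    apply: (le_trans (ler_wpM2l (b0 t A) (le_trans d_y (lerD (lexx _) amgm)))).
    move: (b t A) (bF t A) => bt bt_le.
    rewrite !mulrDr [bt * degree t]mulrC [bt * (lambda / 2)]mulrC.
    rewrite !lerD2l mulrCA ler_wpM2l ?ler_wpM2r ?sqr_ge0//.
    by rewrite invr_ge0 mulr_ge0// ltW.
  rewrite /P !expectD !expectZ; have := Pb t tU; rewrite /P => Pbt.
  have deg0 : 0 <= degree t by apply: sumr_ge0 => E /andP[/nu0].
  apply: lerD; first exact: ler_wpM2l.
  apply: lerD; first by apply: ler_wpM2l => //; lra.
  by apply: ler_wpM2l (Py t); rewrite invr_ge0 mulr_ge0// ltW.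
rewrite !big_split/= -mulr_suml -mulr_sumr -mulr_sumr sumr_const.
rewrite -[P F *+ _]mulr_natr.
apply: (@le_trans _ _ ((\sum_(t in U) degree t) * (delta * P F) +
 (lambda / 2 * (delta * (P F * #|U|%:R)) +
 (2 * lambda)^-1 * (P F * (p * Lambda G nu p))))).
  rewrite !lerD2l -!mulr_sumr; apply: ler_wpM2l.
    by rewrite invr_ge0 mulr_ge0// ltW.
  by apply: ler_wpM2l => //; apply: exposed_degree_variance.
by rewrite le_eqVlt; apply/orP; left; apply/eqP; field; rewrite gt_eqF.
Qed.

End Stuck.

(** * The container lemma, by vertex queries *)

Section Containers.
Variables (R : realType) (V : finType) (s : nat) (p r delta : R) (B : hgraph V).
Hypotheses (Bs : uniform s B) (V0 : (0 < #|V|)%N) (p0 : 0 < p) (p1 : p < 1).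
Hypotheses (r0 : 0 < r) (delta0 : 0 <= delta) (delta1 : delta <= 2 ^- 11).
Hypotheses (delta_s : delta * s%:R <= 2 ^- 11) (pVr : p * #|V|%:R <= 2 ^+ 8 * r).
Implicit Types (A E I S U : {set V}).

Let P (phi : {set V} -> R) := expect p (enum V) phi.
Let p_ge0 : 0 <= p. Proof. exact: ltW. Qed.
Let p_le1 : p <= 1. Proof. exact: ltW. Qed.
Let q0 : 0 < 1 - p. Proof. by rewrite subr_gt0. Qed.

Definition edge_free I := [forall E in B, ~~ (E \subset I)].

Lemma edge_freeS I S : S \subset I -> edge_free I -> edge_free S.
Proof.
move=> SI /forall_inP h; apply/forall_inP => E /h.
by apply: contra => /subset_trans; apply.
Qed.

(** In a state of the algorithm, [S] holds the chosen vertices and [U] the undecided ones. *)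
Definition free_prob U S := P (fun A => (edge_free (A :&: U :|: S))%:R).

Lemma free_prob_remove v U S : v \in U ->
  (1 - p) * free_prob (U :\ v) S <= free_prob U S.
Proof.
move=> vU; rewrite /free_prob /P [leRHS](@expect_split _ _ _ _ v) ?enum_uniq ?mem_enum//.
rewrite -[leLHS]add0r lerD ?mulr_ge0 ?expect_ge0//.
rewrite le_eqVlt; apply/orP; left; apply/eqP; congr (_ * _); apply: eq_expect => A.
by rewrite setIDA setIDAC.
Qed.

Lemma free_prob_ge U S : edge_free S -> (1 - p) ^+ #|U| <= free_prob U S.
Proof.
move=> fS; move: {2}#|U| (erefl #|U|) => k; elim: k U => [|k IH] U Uk.
  rewrite Uk; move/eqP: Uk; rewrite cards_eq0 => /eqP->.
  rewrite /free_prob /P -[leLHS](expect_cst p (enum V)); apply: le_expect => // A.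
  by rewrite setI0 set0U fS.
have /card_gt0P[v vU] : (0 < #|U|)%N by rewrite Uk.
have Uvk : #|U :\ v| = k by move: Uk; rewrite (cardsD1 v) vU => -[].
apply: le_trans (free_prob_remove S vU).
by rewrite Uk exprS ler_pM2l// -Uvk IH.
Qed.

Lemma free_prob_add v U S : v \in U ->
  P (fun A => (edge_free ((v |: A) :&: U :|: S))%:R) = free_prob (U :\ v) (v |: S).
Proof.
move=> vU; apply: eq_expect => A; congr (_ (edge_free _))%:R.
by apply/setP => x; rewrite !inE; case: eqVneq => [->|]; rewrite ?vU ?orbT.
Qed.

Lemma stuck_not_janson U S : edge_free S ->
  (forall v, v \in U ->
    (1 - delta) * free_prob U S <= free_prob (U :\ v) (v |: S)) ->
  ~ janson (induced B (U :|: S)) p r.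
Proof.
move=> fS stuck [nu [nu0 nuL]]; set G := induced _ _ in nu0 nuL.
pose F A : R := (edge_free (A :&: U :|: S))%:R.
have F0 A : 0 <= F A by [].
have Fdec A A' : A \subset A' -> F A' <= F A.
  move=> AA'; rewrite /F ler_nat.
  have sub : A :&: U :|: S \subset A' :&: U :|: S by rewrite setSU// setSI.
  by case: (boolP (edge_free (A' :&: _ :|: _))) => // /(edge_freeS sub)->.
have FG E A : E \in G -> E :&: U \subset A -> F A = 0.
  rewrite inE => /andP[EB EUS] EUA; rewrite /F.
  case: (boolP (edge_free _)) => // /forall_inP/(_ _ EB)/negP[].
  apply/subsetP => x xE; rewrite !inE; have := subsetP EUS _ xE; rewrite !inE.
  case/orP => [xU|->]; last by rewrite orbT.
  by rewrite xU (subsetP EUA)// inE xE.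
have stuckF v : v \in U -> (1 - delta) * P F <= P (fun A => F (v |: A)).
  by move=> vU; rewrite [leRHS](free_prob_add S vU); apply: stuck.
have PF0 : 0 < P F by apply: lt_le_trans (free_prob_ge U fS); rewrite exprn_gt0.
set e := e_nu G nu in nuL *.
have e_ge0 : 0 <= e by apply: sumr_ge0.
have e0 : 0 < e.
  rewrite lt_neqAle e_ge0 andbT; apply/eqP => e0.
  by move: nuL; rewrite -e0 expr0n mul0r ltNge Lambda_ge0.
have n0 : 0 < #|V|%:R :> R by rewrite ltr0n.
(* With this scale the last two terms of the mass bound are at most [e / 8] and [e / 4]; the first
   is at most [2 ^- 11 * e], so the sum stays below [e]. *)
pose lambda := 2 ^+ 9 * e / #|V|%:R.
have l0 : 0 < lambda by rewrite divr_gt0// mulr_gt0// exprn_gt0.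
have := @stuck_mass_bound _ _ p G nu U p0 p_le1 nu0 F F0 Fdec FG delta lambda l0 stuckF.
rewrite -/(P F) -/e mulrC ler_pM2l//; apply/negP; rewrite -ltNge.
have deg : \sum_(t in U) degree G nu t <= s%:R * e.
  rewrite /degree (exchange_big_dep (fun E => E \in G))/=; last by move=> t E _ /andP[].
  rewrite mulr_sumr; apply: ler_sum => E EG.
  rewrite (eq_bigl (mem (U :&: E))); last by move=> t; rewrite EG /= !inE.
  rewrite sumr_const -[nu E *+ _]mulr_natl ler_wpM2r ?nu0// ler_nat.
  move: EG; rewrite inE => /andP[/Bs<- _].
  by rewrite subset_leq_card ?subsetIr.
have t1 : delta * (\sum_(t in U) degree G nu t) <= 2 ^- 11 * e.
  apply: (le_trans (ler_wpM2l delta0 deg)).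
  by rewrite mulrA ler_wpM2r.
have t2 : lambda / 2 * delta * #|U|%:R <= 2 ^- 3 * e.
  have -> : 2 ^- 3 * e = lambda / 2 * 2 ^- 11 * #|V|%:R.
    by rewrite /lambda; field; rewrite gt_eqF.
  have l20 : 0 <= lambda / 2 by lra.
  apply: ler_pM; rewrite ?ler0n ?ler_nat ?max_card//; first exact: mulr_ge0.
  exact: ler_wpM2l.
have t3 : p * Lambda G nu p / (2 * lambda) <= 2 ^- 2 * e.
  have l20 : 0 < 2 * lambda by lra.
  rewrite ler_pdivrMr//.
  apply: (@le_trans _ _ (p * (e ^+ 2 / r))); first by rewrite ler_wpM2l// ltW.
  have -> : 2 ^- 2 * e * (2 * lambda) = 2 ^+ 8 / #|V|%:R * e ^+ 2.
    by rewrite /lambda; field; rewrite gt_eqF.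
  rewrite mulrCA mulrC ler_wpM2r ?sqr_ge0//.
  by rewrite ler_pdivrMr// mulrAC ler_pdivlMr.
apply: (le_lt_trans (lerD (lerD t1 t2) t3)).
rewrite -!mulrDl gtr_pMl//; lra.
Qed.

(** The hypothesis is a loop invariant. Choosing a vertex gains a factor [1 - delta]; deleting one
    raises the probability by at most [1 / (1 - p)], which the growing exponent absorbs. *)
Lemma containers_from_state U S :
  free_prob U S * (1 - p) ^+ (#|V| - #|U|) <= (1 - delta) ^+ #|S| ->
  exists f : {set V} -> {set V}, forall I,
    edge_free I -> S \subset I -> I \subset U :|: S ->
    exists S', [/\ S \subset S', S' \subset I, I \subset f S',
      (1 - p) ^+ #|V| <= (1 - delta) ^+ #|S'| & ~ janson (induced B (f S')) p r].
Proof.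
have d1 : delta <= 1.
  by apply: (le_trans delta1); rewrite invf_le1 ?exprn_ege1 ?exprn_gt0 ?ler1n.
have [k] := ubnP #|U|; elim: k U S => // k IH U S Uk inv.
have [/exists_inP[v vU query]|none] :=
  boolP [exists v in U, free_prob (U :\ v) (v |: S) < (1 - delta) * free_prob U S];
  last first.
  exists (fun=> U :|: S) => I fI SI IUS; exists S.
  have fS := edge_freeS SI fI; split => //.
    apply: le_trans inv; rewrite -[in leLHS](subnKC (max_card (mem U))) exprD.
    by rewrite ler_wpM2r ?exprn_ge0 ?(ltW q0)// free_prob_ge.
  apply: stuck_not_janson => // v vU; rewrite leNgt; apply/negP => query.
  by move/negP: none; apply; apply/exists_inP; exists v.
have cU : #|U| = #|U :\ v|.+1 by rewrite (cardsD1 v) vU.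
have Uvk : (#|U :\ v| < k)%N by rewrite -cU.
have VU : (#|V| - #|U :\ v| = (#|V| - #|U|).+1)%N by rewrite cU subnSK// -cU max_card.
have [|fin fin_ok] := IH (U :\ v) (v |: S) Uvk.
  apply: (@le_trans _ _ ((1 - delta) * free_prob U S * (1 - p) ^+ (#|V| - #|U|))).
    apply: ler_pM; rewrite ?expect_ge0 ?exprn_ge0 ?(ltW q0) ?(ltW query)//.
    by rewrite VU exprS ler_piMl ?exprn_ge0 ?(ltW q0)// lerBlDr lerDl ltW.
  apply: (@le_trans _ _ ((1 - delta) ^+ #|S|.+1)).
    by rewrite -mulrA exprS ler_wpM2l// subr_ge0.
  by rewrite ler_wiXn2l ?subr_ge0// ?lerBlDr ?lerDl// cardsU1; case: (v \notin S).
have [|fout fout_ok] := IH (U :\ v) S Uvk.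
  apply: le_trans inv; rewrite VU exprS mulrA [_ * (1 - p)]mulrC.
  by rewrite ler_wpM2r ?exprn_ge0 ?(ltW q0) ?free_prob_remove.
(* The fingerprint records the answer: it keeps chosen vertices and lies in [I], so [v \in S']
   exactly when [v \in I]. *)
exists (fun S' => if v \in S' then fin S' else fout S') => I fI SI IUS.
have [vI|vI] := boolP (v \in I).
  have [||S' [vSS' S'I IS' b nj]] := fin_ok I fI.
  - by rewrite subUset sub1set vI.
  - apply: (subset_trans IUS); apply/subsetP => x; rewrite !inE.
    by case: (x == v) => //=.
  have vS' : v \in S' by rewrite (subsetP vSS')// setU11.
  exists S'; split => //; rewrite ?vS'//.
  by apply: subset_trans vSS'; apply: subsetUr.
have [||S' [SS' S'I IS' b nj]] := fout_ok I fI => //.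
  apply/subsetP => x xI; have := subsetP IUS _ xI; rewrite !inE.
  by case: eqVneq xI vI => // -> ->.
have vS' : v \notin S' by apply: contra vI => /(subsetP S'I).
by exists S'; rewrite (negPf vS'); split.
Qed.

Lemma containers : exists f : {set V} -> {set V}, forall I, edge_free I ->
  exists S, [/\ S \subset I, I \subset f S,
    (1 - p) ^+ #|V| <= (1 - delta) ^+ #|S| & ~ janson (induced B (f S)) p r].
Proof.
have [|f f_ok] := @containers_from_state setT set0.
  rewrite cards0 expr0 cardsT subnn expr0 mulr1 -[leRHS](expect_cst p (enum V)).
  by apply: le_expect => // A; rewrite -[1]/(1%:R) ler_nat; case: edge_free.
exists f => I fI; have [||S [_ SI IS b nj]] := f_ok I fI; rewrite ?sub0set//.
  by rewrite setU0 subsetT.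
by exists S.
Qed.

End Containers.

(** * Random sampling and bad edges *)

Lemma sum_subsets_expr (R : comPzRingType) (V : finType) (x : R) (K : {set V}) :
  \sum_(L : {set V} | L \subset K) x ^+ #|L| = (1 + x) ^+ #|K|.
Proof.
transitivity (\prod_(i : V) ((if i \in K then x else 0) + 1)).
  rewrite bigA_distr big_mkcond; apply: eq_bigr => L _.
  rewrite -(big_mkcond (fun i => i \in L)) /=; case: ifP => [LK|/negbT].
    rewrite -prodr_const; apply: eq_bigr => i iL.
    by rewrite (subsetP LK).
  case/subsetPn => i iL iK; rewrite (bigD1 i)//= (negPf iK) mul0r//.
rewrite -prodr_const [RHS]big_mkcond; apply: eq_bigr => i _.
by case: ifP; rewrite ?add0r// addrC.
Qed.

Section Sampling.
Variables (R : realType) (V : finType) (s : nat) (p q r alpha eta : R) (H : hgraph V).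
Hypotheses (Hs : uniform s H) (p0 : 0 < p) (pq : p < q) (q1 : q < 1) (r0 : 0 < r).
Hypotheses (alpha0 : 0 <= alpha) (alpha1 : alpha < 1) (eta0 : 0 < eta).
Hypothesis eta_le : eta <= (1 - alpha) ^+ (2 * s) / 4.
Implicit Types (A D E K T : {set V}).

Let p' := p / (q - p).
Let P (phi : {set V} -> R) := expect q (enum V) phi.
Let q0 : 0 < q. Proof. exact: lt_trans pq. Qed.
Let q_ge0 : 0 <= q. Proof. exact: ltW. Qed.
Let q_le1 : q <= 1. Proof. exact: ltW. Qed.
Let p'0 : 0 < p'. Proof. by rewrite divr_gt0// subr_gt0. Qed.
Let qx k : q ^+ k != 0. Proof. by rewrite expf_neq0// gt_eqF. Qed.

(* The density [p / (q - p)] is chosen so that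
   [q ^- k * (1 + (q - p) / p) ^+ k = p ^- k]. *)
Lemma pair_weight_sample K :
  q ^- #|K| * pair_weight p' K <= pair_weight p K.
Proof.
have p'V : p'^-1 = (q - p) / p by rewrite invf_div.
have [K2|K2] := ltnP #|K| 2.
  rewrite {1}/pair_weight big_pred0 ?mulr0 ?pair_weight_ge0 ?(ltW p0)// => L.
  apply/negP => /andP[L2 /subset_leq_card LK].
  by move: (leq_trans L2 LK); rewrite leqNgt K2.
apply: (@le_trans _ _ (p ^- #|K|)); last first.
  rewrite /pair_weight (bigD1 K) ?K2//= lerDl sumr_ge0// => L _.
  by rewrite invr_ge0 exprn_ge0// ltW.
rewrite mulrC ler_pdivrMr ?exprn_gt0// mulrC -expr_div_n.
have -> : q / p = 1 + p'^-1 by rewrite p'V; field; rewrite gt_eqF.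
rewrite -sum_subsets_expr /pair_weight big_mkcond [leRHS]big_mkcond.
apply: ler_sum => L _; rewrite exprVn; case: (L \subset K) => /=; last by rewrite andbF.
by rewrite andbT; case: ifP => // _; rewrite invr_ge0 exprn_ge0// ltW.
Qed.

Definition avoids A : bool :=
  `[< forall L : {set V}, L \subset A -> ~ janson (induced H L) p' (eta * r) >].

Lemma avoidsS A D : A \subset D -> avoids D -> avoids A.
Proof.
move=> AD /asboolP avD; apply/asboolP => L LA.
exact: avD (subset_trans LA AD).
Qed.

Definition avoid_prob T := P (fun A => (avoids (A :|: T))%:R).

Lemma avoid_prob_ge T : avoids T -> (1 - q) ^+ #|V| <= avoid_prob T.
Proof.
move=> avT; have := @expect_ge_set0 _ _ q q_ge0 q_le1 (enum V)
  (fun A => (avoids (A :|: T))%:R).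
by rewrite -cardE set0U avT mulr1; apply.
Qed.

Lemma avoid_prob_le1 T : avoid_prob T <= 1.
Proof.
rewrite -[leRHS](expect_cst q (enum V)); apply: le_expect => // A.
by rewrite -[1]/(1%:R) ler_nat; case: avoids.
Qed.

Section SecondMoment.
Variables (D T : {set V}) (nu : {set V} -> R).
Let G := induced H D.
Hypotheses (nu0 : forall E, E \in G -> 0 <= nu E) (avT : avoids T).

(** The inverse of the probability that [E \subset A :|: T], so that sampling preserves weights on
    average. *)
Let c E := q ^- #|E :\: T|.
Let c0 E : 0 <= c E. Proof. by rewrite invr_ge0 exprn_ge0. Qed.

(** Zero outside [G], since [A :|: T] may contain edges not inside [D]. *)
Let nu' E : R := if E \in G then nu E * c E else 0.

Lemma sample_sum A (g : {set V} -> R) :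
  \sum_(E in induced H (A :|: T)) nu' E * g E =
  \sum_(E in G) nu E * c E * g E * (E :\: T \subset A)%:R.
Proof.
rewrite big_mkcond [RHS]big_mkcond; apply: eq_bigr => E _; rewrite /nu'.
have [EG|_] := boolP (E \in G); last by rewrite mul0r if_same.
have EH : E \in H by move: EG; rewrite inE => /andP[].
by rewrite inE EH /= subDset setUC; case: ifP => _; rewrite ?mulr1 ?mulr0.
Qed.

Lemma sample_Lambda A :
  Lambda (induced H (A :|: T)) nu' p' =
  \sum_(E in G) \sum_(E' in G) nu E * nu E' * (c E * c E') *
    pair_weight p' (E :&: E') * ((E :|: E') :\: T \subset A)%:R.
Proof.
rewrite Lambda_pairs.
under eq_bigr do under eq_bigr do rewrite -mulrA.
under eq_bigr do rewrite -mulr_sumr.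
rewrite sample_sum; apply: eq_bigr => E _; rewrite sample_sum.
rewrite mulr_sumr mulr_suml; apply: eq_bigr => E' _.
by rewrite setDUl subUset -mulnb natrM; ring.
Qed.

Lemma sample_Lambda_mono A A' : A \subset A' ->
  Lambda (induced H (A :|: T)) nu' p' <= Lambda (induced H (A' :|: T)) nu' p'.
Proof.
move=> AA'; rewrite !sample_Lambda; apply: ler_sum => E EG; apply: ler_sum => E' E'G.
rewrite ler_wpM2l ?mulr_ge0 ?nu0 ?c0 ?pair_weight_ge0 ?(ltW p'0)// ler_nat.
by case: (boolP (_ \subset A)) => // /subset_trans->.
Qed.

(** A pair of edges keeps the factor [q ^- #|(E :&: E') :\: T|], which [pair_weight_sample] absorbs
    in passing from [p'] to [p]. *)
Lemma expect_sample_Lambda :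
  P (fun A => Lambda (induced H (A :|: T)) nu' p') <= Lambda G nu p.
Proof.
rewrite /P (eq_expect _ _ sample_Lambda) expect_sum Lambda_pairs.
apply: ler_sum => E EG; rewrite expect_sum; apply: ler_sum => E' E'G.
rewrite expectZ expect_subset1 -!mulrA.
apply: ler_wpM2l; rewrite ?nu0//; apply: ler_wpM2l; rewrite ?nu0//.
apply: le_trans (pair_weight_sample (E :&: E')).
have -> : c E * (c E' * (pair_weight p' (E :&: E') * q ^+ #|(E :|: E') :\: T|)) =
    q ^+ #|(E :|: E') :\: T| * (c E * c E') * pair_weight p' (E :&: E') by ring.
rewrite ler_wpM2r ?pair_weight_ge0 ?(ltW p'0)//.
have := cardsUI (E :\: T) (E' :\: T); rewrite -setDUl -setDIl /c.
set a := #|_|; set b := #|_|; set k := #|E :\: T|; set k' := #|E' :\: T| => abkk.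
have -> : q ^+ a * (q ^- k * q ^- k') = q ^- b.
  by rewrite -invfM -exprD -abkk exprD invfM mulrA mulfV ?mul1r.
rewrite lef_pV2 ?posrE ?exprn_gt0// ler_wiXn2l//.
by rewrite subset_leq_card// subsetDl.
Qed.

Lemma expect_sample_mass :
  P (fun A => (avoids (A :|: T))%:R * e_nu (induced H (A :|: T)) nu') =
  \sum_(E in G) nu E * avoid_prob (T :|: E).
Proof.
transitivity (P (fun A => \sum_(E in G)
    nu E * c E * ((avoids (A :|: T))%:R * (E :\: T \subset A)%:R))).
  apply: eq_expect => A.
  have := sample_sum A (fun=> 1); under eq_bigr do rewrite mulr1.
  rewrite /e_nu => ->; rewrite mulr_sumr; apply: eq_bigr => E _; ring.
rewrite /P expect_sum; apply: eq_bigr => E _; rewrite expectZ.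
rewrite (expect_subset q (E :\: T) (fun A => (avoids (A :|: T))%:R)).
rewrite -mulrA [c E * _]mulrA /c mulVf// mul1r; congr (_ * _).
apply: eq_expect => A; congr (_ (avoids _))%:R; apply/setP => x; rewrite !inE.
by case: (x \in T); case: (x \in E); case: (x \in A).
Qed.

(** If [A :|: T] avoids the Janson sets, the sampled weights are no witness, so their squared mass
    is at most [eta * r] times their [Lambda]. Harris separates the decreasing avoidance event from
    the increasing [Lambda]. *)
Lemma sample_mass_lt : Lambda G nu p < e_nu G nu ^+ 2 / r ->
  \sum_(E in G) nu E * avoid_prob (T :|: E)
    < (1 - alpha) ^+ s * e_nu G nu / 2 * avoid_prob T.
Proof.
move=> nuL; set e := e_nu G nu in nuL *.
have e_ge0 : 0 <= e by apply: sumr_ge0.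
have e0 : 0 < e.
  rewrite lt_neqAle e_ge0 andbT; apply/eqP => e0.
  by move: nuL; rewrite -e0 expr0n mul0r ltNge Lambda_ge0// ltW.
have avT0 : 0 < avoid_prob T.
  by apply: lt_le_trans (avoid_prob_ge avT); rewrite exprn_gt0// subr_gt0.
(* With this threshold, [eta_le] gives [eta * e ^+ 2 <= k ^+ 2]. *)
pose k := (1 - alpha) ^+ s * e / 2; rewrite -/k.
have k0 : 0 < k by rewrite divr_gt0// mulr_gt0// exprn_gt0// subr_gt0.
pose f A : R := (avoids (A :|: T))%:R.
pose X A := e_nu (induced H (A :|: T)) nu'.
pose L A := Lambda (induced H (A :|: T)) nu' p'.
have er0 : 0 < eta * r by rewrite mulr_gt0.
have nu'0 E : 0 <= nu' E by rewrite /nu'; case: ifP => // /nu0 ?; rewrite mulr_ge0.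
(* The square of [X A] is replaced by its tangent at [k], making the bound linear in the mass. *)
have fXL A : f A * (2 * k * X A - k ^+ 2) <= eta * r * (f A * L A).
  rewrite [leRHS]mulrCA /f; case: (boolP (avoids _)) => [/asboolP av|_];
    last by rewrite mulr0n !mul0r.
  rewrite mulr1n !mul1r; apply: (@le_trans _ _ (X A ^+ 2)).
    rewrite -subr_ge0 (_ : _ - _ = (X A - k) ^+ 2) ?sqr_ge0//; ring.
  rewrite mulrC -ler_pdivrMr// leNgt; apply/negP => lt.
  by apply: (av _ (subxx _)); exists nu'.
have fdec A A' : A \subset A' -> f A' <= f A.
  move=> AA'; rewrite /f ler_nat.
  by case: (boolP (avoids (A' :|: T))) => // /(avoidsS (setSU T AA'))->.
have key : 2 * k * P (fun A => f A * X A) - k ^+ 2 * avoid_prob T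
    <= eta * r * (avoid_prob T * Lambda G nu p).
  apply: (@le_trans _ _ (P (fun A => f A * (2 * k * X A - k ^+ 2)))).
    rewrite le_eqVlt; apply/orP; left; apply/eqP.
    rewrite /avoid_prob /P -mulNr -!expectZ -expectD; apply: eq_expect => A.
    by rewrite -/(f A); ring.
  apply: (@le_trans _ _ (P (fun A => eta * r * (f A * L A)))); first exact: le_expect.
  rewrite /P expectZ ler_wpM2l ?(ltW er0)//.
  apply: (le_trans (harris q_ge0 q_le1 (enum V) fdec sample_Lambda_mono)).
  by rewrite ler_wpM2l ?(ltW avT0)// expect_sample_Lambda.
have small : eta * r * (avoid_prob T * Lambda G nu p) < k ^+ 2 * avoid_prob T.
  rewrite mulrCA mulrC ltr_pM2r//; apply: (@lt_le_trans _ _ (eta * e ^+ 2)).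
    by rewrite -mulrA ltr_pM2l// mulrC -ltr_pdivlMr.
  have -> : k ^+ 2 = (1 - alpha) ^+ (2 * s) / 4 * e ^+ 2.
    by rewrite /k mulnC exprM; field.
  by rewrite ler_wpM2r ?sqr_ge0.
have := le_lt_trans key small; rewrite expect_sample_mass.
rewrite ltrBlDr => lt.
rewrite -(ltr_pM2l (_ : 0 < 2 * k)); last lra.
by apply: (lt_le_trans lt); rewrite le_eqVlt; apply/orP; left; apply/eqP; ring.
Qed.

End SecondMoment.

Definition bad_edges T : hgraph V :=
  [set E in H | avoid_prob (T :|: E) < (1 - alpha) ^+ s * avoid_prob T].

(** By [sample_mass_lt], edges that are not bad carry less than half of [nu]. Restriction does not
    increase [Lambda], and half the mass costs a factor 4. *)
Lemma bad_edges_janson D T : avoids T ->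
  janson (induced H D) p r -> janson (induced (bad_edges T) D) p (r / 4).
Proof.
move=> avT [nu [nu0 nuL]]; have lt := sample_mass_lt nu0 avT nuL.
set G := induced H D in nu0 nuL lt; set B := induced _ _.
have BG : B \subset G by apply/subsetP => E; rewrite !inE => /andP[/andP[-> _] ->].
exists nu; split=> [E /(subsetP BG)/nu0//|].
have avT0 : 0 < avoid_prob T.
  by apply: lt_le_trans (avoid_prob_ge avT); rewrite exprn_gt0// subr_gt0.
have a0 : 0 < (1 - alpha) ^+ s by rewrite exprn_gt0// subr_gt0.
have split_e : e_nu G nu = e_nu B nu + \sum_(E in G | E \notin B) nu E.
  rewrite /e_nu (bigID (fun E => E \in B))/=; congr (_ + _); apply: eq_bigl => E.
  by case: (boolP (E \in B)) => [/(subsetP BG)->//|]; rewrite andbF.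
have good : (1 - alpha) ^+ s * avoid_prob T * \sum_(E in G | E \notin B) nu E
    <= \sum_(E in G) nu E * avoid_prob (T :|: E).
  rewrite mulr_sumr [leRHS](bigID (fun E => E \in B))/= -[leLHS]add0r; apply: lerD.
    apply: sumr_ge0 => E /andP[EG _]; rewrite mulr_ge0 ?nu0//.
    exact: expect_ge0.
  apply: ler_sum => E /andP[EG EB]; rewrite mulrC ler_wpM2l ?nu0// leNgt.
  by apply: contra EB => bad; move: EG; rewrite !inE => /andP[-> ->]; rewrite bad.
have good_lt : \sum_(E in G | E \notin B) nu E < e_nu G nu / 2.
  have := le_lt_trans good lt; rewrite -!mulrA [avoid_prob T * _]mulrC.
  by rewrite !mulrA ltr_pM2r// -mulrA ltr_pM2l.
have e_ge0 : 0 <= e_nu G nu by apply: sumr_ge0.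
apply: (@le_lt_trans _ _ (Lambda G nu p)).
  apply: ler_sum => L _; rewrite ler_wpM2r ?invr_ge0 ?exprn_ge0 ?(ltW p0)//.
  rewrite lerXn2r ?nnegrE ?sumr_ge0//.
  - by move=> E /andP[/(subsetP BG)/nu0].
  - by move=> E /andP[/nu0].
  rewrite /d_nu big_mkcond [leRHS]big_mkcond; apply: ler_sum => E _.
  have [EB|_] := boolP (E \in B); first by rewrite (subsetP BG).
  by case: ifP => // /andP[/nu0].
apply: (lt_le_trans nuL).
have -> : e_nu B nu ^+ 2 / (r / 4) = (2 * e_nu B nu) ^+ 2 / r by field; rewrite gt_eqF.
rewrite ler_wpM2r ?invr_ge0 ?(ltW r0)// lerXn2r ?nnegrE//; lra.
Qed.

(** If [E] were a bad edge in [I], then [T :|: E], with at most [s] new elements, would still be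
    admissible; maximality gives [E \subset T], and then [E] is not bad. *)
Lemma saturated_fingerprint I : avoids I ->
  exists T : {set V}, [/\ T \subset I, avoid_prob T <= (1 - alpha) ^+ #|T|
    & edge_free (bad_edges T) I].
Proof.
move=> avI.
pose ok T := (T \subset I) && (avoid_prob T <= (1 - alpha) ^+ #|T|).
have ok0 : ok set0 by rewrite /ok sub0set cards0 expr0 avoid_prob_le1.
case: (@arg_maxnP _ set0 ok (fun T => #|T|) ok0) => T /andP[TI Tle] Tmax.
exists T; split=> //; apply/forall_inP => E; rewrite inE => /andP[EH bad].
apply/negP => EI.
have a0 : 0 <= 1 - alpha by rewrite subr_ge0 ltW.
have a1 : 1 - alpha <= 1 by rewrite lerBlDr lerDl.
have okTE : ok (T :|: E).
  rewrite /ok subUset TI EI /=; apply: (le_trans (ltW bad)).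
  apply: (@le_trans _ _ ((1 - alpha) ^+ (s + #|T|))).
    by rewrite exprD ler_wpM2l// exprn_ge0.
  by rewrite ler_wiXn2l// addnC -(Hs EH) leq_card_setU.
have TE : T :|: E = T.
  apply/esym/eqP; rewrite eqEcard subsetUl /=; exact: Tmax.
have avT0 : 0 <= avoid_prob T by apply: expect_ge0.
move: bad; rewrite TE; apply/negP; rewrite -leNgt ler_piMl//.
exact: exprn_ile1.
Qed.

End Sampling.

(** * Assembling fingerprints and containers *)

Theorem theorem4p6 (R : realType) (V : finType) (s n : nat)
  (p q r alpha eta : R) (H : hgraph V) :
  #|V| = n -> (s <= n)%N ->
  0 < p -> 0 < q -> 0 < r -> 0 < alpha -> 0 < eta ->
  p <= 1 / (2 ^+ 11 * s%:R ^+ 2) ->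
  2 * p <= q -> q <= alpha -> alpha < 1 ->
  r >= 2 ^- 6 * p * n%:R ->
  eta <= (1 - alpha) ^+ (2 * s) / 4 ->
  uniform s H ->
  let J := fun L : {set V} => janson (induced H L) (p / (q - p)) (eta * r) in
  exists (Y : {set {set V} * {set V}})
         (g : {set V} -> {set V} * {set V})
         (f : {set V} * {set V} -> {set V}),
    (forall I, independent J I ->
       g I \in Y /\ ((g I).1 :|: (g I).2 \subset I) /\ (I \subset f (g I))) /\
    (forall Y0, Y0 \in Y ->
       (#|Y0.1|%:R <= 2 ^+ 11 * p * s%:R ^+ 2 * n%:R) /\
       (#|Y0.2|%:R <= q * n%:R / alpha)) /\
    (forall Y0, Y0 \in Y -> ~ janson (induced H (f Y0)) p r).
Proof.
move=> Vn sn p0 q0 r0 a0 eta0 ps p2q qa a1 rpn eta_le Hs J.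
(* For [s = 0] the bound on [p] is a division by zero, whose value is zero, against [0 < p]. *)
have s0 : (0 < s)%N.
  rewrite lt0n; apply/eqP => s0; move: ps.
  by rewrite s0 expr0n mulr0 invr0 mulr0 leNgt p0.
have s1 : 1 <= s%:R :> R by rewrite ler1n.
(* Chosen so that the bound [p * n / delta] from [exponent_bound] is the required one on [S]. *)
pose delta : R := (2 ^+ 11 * s%:R ^+ 2)^-1.
have delta0 : 0 < delta by rewrite invr_gt0 mulr_gt0 ?exprn_gt0 ?ltr0n.
have delta_s : delta * s%:R <= 2 ^- 11.
  rewrite /delta invfM -mulrA ler_piMr ?invr_ge0 ?exprn_ge0//.
  by rewrite mulrC expr2 invfM mulrA divff ?mul1r ?invf_le1 ?gt_eqF ?ltr0n.
have delta1 : delta <= 2 ^- 11.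
  by apply: le_trans delta_s; rewrite ler_peMr ?(ltW delta0).
have two : 2 ^- 11 < 1 :> R by lra.
have pd : p <= delta by rewrite -[delta]mul1r.
have p1 : p < 1 by lra.
have V0 : (0 < #|V|)%N by rewrite Vn (leq_trans s0).
have pq : p < q by lra.
have q1 : q < 1 by lra.
have r40 : 0 < r / 4 by lra.
have pVr : p * #|V|%:R <= 2 ^+ 8 * (r / 4) by rewrite Vn; lra.
pose av A := avoids p q r eta H A.
pose bad T := bad_edges s p q r alpha eta H T.
have /choice[f f_ok] : forall T, exists f : {set V} -> {set V}, forall I,
    edge_free (bad T) I -> exists S : {set V}, [/\ S \subset I, I \subset f S,
    (1 - p) ^+ #|V| <= (1 - delta) ^+ #|S| & ~ janson (induced (bad T) (f S)) p (r / 4)].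
  move=> T; apply: (@containers _ _ s) => //; last exact: ltW.
  by move=> E; rewrite inE => /andP[/Hs].
pose ok (y : {set V} * {set V}) := [/\ #|y.1|%:R <= 2 ^+ 11 * p * s%:R ^+ 2 * n%:R,
  #|y.2|%:R <= q * n%:R / alpha & ~ janson (induced H (f y.2 y.1)) p r].
have /choice[g g_ok] : forall I, exists y : {set V} * {set V}, independent J I ->
    [/\ ok y, y.1 :|: y.2 \subset I & I \subset f y.2 y.1].
  (* Sets that are not independent get a dummy pair. *)
  move=> I; have [Iind|] := pselect (independent J I); last by exists (set0, set0).
  have avI : av I by apply/asboolP => L LI JL; apply: (Iind L JL).
  have [T [TI Tle freeI]] := saturated_fingerprint Hs p0 pq q1 (ltW a0) a1 avI.
  have [S [SI IS Sle nj]] := f_ok T I freeI.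
  exists (S, T) => _; split => //=; last by rewrite subUset SI TI.
  have avT : av T := avoidsS TI avI.
  split=> /=.
  - have := exponent_bound delta0 _ p1 (max_card (mem S)) Sle.
    rewrite Vn /delta invrK => /(_ (ltW (le_lt_trans delta1 two)))/le_trans; apply.
    by rewrite le_eqVlt; apply/orP; left; apply/eqP; ring.
  - rewrite -Vn; apply: (exponent_bound a0 (ltW a1) q1 (max_card (mem T))).
    exact: le_trans (avoid_prob_ge p0 pq q1 avT) Tle.
  - by move=> HJ; apply: nj; apply: bad_edges_janson HJ.
(* [Y] consists of all pairs satisfying (2) and (3), so these hold by definition. *)
exists [set y | `[< ok y >]], g, (fun y => f y.2 y.1); split; [|split].
- by move=> I /g_ok[ok_g sub cont]; rewrite inE; split => //; apply/asboolP.
- by move=> y; rewrite inE => /asboolP[].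
- by move=> y; rewrite inE => /asboolP[].
Qed.
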